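(* In the setting and with the notation of the context, assume that: (A1) the stratum density $\rho$ is of integrated curved exponential form; (A2) for all $\eta$ and all $(x,\tilde x)\in\Xi\times\tilde\Xi$, the expectation $\int\mathbf{s}(x,\tilde x,\mathbf{u})\,\bar\rho(\mathbf{u}\mid x,\tilde x;\eta)\,d\mathbf{u}$ is available in closed form; (A3) there are subsets $\boldsymbol{\Pi}\subseteq\mathbb{R}_+^d$ and $\boldsymbol{\Sigma}\subseteq\mathbb{R}^{m\times m'}$ such that for all $\mathbf{s}=(\mathbf{s}_1,\dots,\mathbf{s}_d)\in\boldsymbol{\Sigma}^d$ and $\mathbf{p}\in\boldsymbol{\Pi}$ the mapping $\theta\mapsto l(\mathbf{s},\mathbf{p};\theta)$ has a unique global maximum, denoted by $\bar\theta(\mathbf{s},\mathbf{p})=\arg\max_{\theta\in\Theta}l(\mathbf{s},\mathbf{p};\theta)$. Then the following holds true. (i) If $(\mathbf{s}^*,\mathbf{p}^* )$ is a root of the mean field $\mathbf{h}$, then $\bar\theta(\mathbf{s}^*,\mathbf{p}^* )$ is a stationary point of $\theta\mapsto d_{\mathrm{KL}}(\bar\mu\,\|\,\pi_\theta)$, i.e. $\nabla_\theta d_{\mathrm{KL}}(\bar\mu\,\|\,\pi_\theta)\big|_{\theta=\bar\theta(\mathbf{s}^*,\mathbf{p}^* )}=\mathbf{0}$. (ii) Conversely, if $\theta^*$ is a stationary point of $\theta\mapsto d_{\mathrm{KL}}(\bar\mu\,\|\,\pi_\theta)$, then $(\mathbf{s}^*,\mathbf{p}^* )$ with $\mathbf{s}^*=\bar{\mathbf{s}}(\theta^*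 )$ and $\mathbf{p}^*=\bar{\mathbf{p}}(\theta^* )$ is a root of $\mathbf{h}$.
   Context: **Spaces and target.** Let $\Xi=\mathbb{R}^{p}$, $\tilde\Xi=\mathbb{R}^{\tilde p}$, and let $\ell:\Xi\times\tilde\Xi\to\mathbb{R}_+$ be an un-normalised transition density. Fix $N\ge 1$, points (ancestor particles) $X_1,\dots,X_N\in\Xi$ with associated nonnegative importance weights $\omega_1,\dots,\omega_N$, and a positive adjustment multiplier function $\psi$ on $\Xi$. The auxiliary target $\bar\mu$ is the probability distribution on $\{1,\dots,N\}\times\tilde\Xi$ with density $$\bar\mu(i,\tilde x)=\frac{\omega_i\,\ell(X_i,\tilde x)}{\sum_{j=1}^N\omega_j\int\ell(X_j,\tilde x')\,d\tilde x'} .$$ $\mathbb{E}_{\bar\mu}$ denotes expectation when $(I,\tilde X)\sim\bar\mu$, with $X_1,\dots,X_N$ regarded as fixed. **Integrated curved exponential form.** There exist a state space $\boldsymbol{\Upsilon}\subseteq\mathbb{R}^u$ and a Markov transition kernel from $\Xi$ to $\tilde\Xi\times\boldsymbol{\Upsilon}$, parametrised by $\eta$, having a density of the form $$\bar\rho(x,(\tilde x,\mathbf{u});\eta)=\gamma(\mathbf{u})\,h_0(x,\tilde x,\mathbf{u})\exp\!\big(-a(\eta)+\mathrm{Tr}(\mathbf{b}(\eta)^\top\mathbf{s}(x,\tilde x,\mathbf{u}))\big),$$ where $\gamma,h_0,a$ are real-valued and $\mathbf{s},\mathbf{b}$ are $\mathbb{R}^{m\times m'}$-valued, such that $$\rho(x,\tilde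 x;\eta)=\int_{\boldsymbol{\Upsilon}}\bar\rho(x,(\tilde x,\mathbf{u});\eta)\,d\mathbf{u}.$$ The conditional density of $\mathbf{u}$ is $$\bar\rho(\mathbf{u}\mid x,\tilde x;\eta)=\frac{\bar\rho(x,(\tilde x,\mathbf{u});\eta)}{\rho(x,\tilde x;\eta)} .$$ **Proposal family (constant mixture weights).** Fix an integer $d\ge1$. The parameter is $\theta=(\beta_1,\dots,\beta_d,\eta_1,\dots,\eta_d)\in\Theta$, where $\beta_1,\dots,\beta_d$ are nonnegative scalars summing to one. The proposal distribution on $\{1,\dots,N\}\times\tilde\Xi$ is $$\pi_\theta(i,\tilde x)=\frac{\omega_i\psi(X_i)}{\sum_{k=1}^N\omega_k\psi(X_k)}\sum_{j=1}^d\beta_j\,\rho(X_i,\tilde x;\eta_j).$$ It is required throughout that $\sum_j\beta_j\rho(x,\tilde x;\eta_j)=0$ implies $\ell(x,\tilde x)=0$, so that $\bar\mu$ is absolutely continuous with respect to $\pi_\theta$. The Kullback–Leibler divergence is $d_{\mathrm{KL}}(\bar\mu\|\pi_\theta)=\mathbb{E}_{\bar\mu}[\log(\bar\mu(I,\tilde X)/\pi_\theta(I,\tilde X))]$. **Responsibilities and expected statistics.** For $1\le j\le d$, $$\bar\pi_\theta(j\mid i,\tilde x)=\frac{\beta_j\,\rho(X_i,\tilde x;\eta_j)}{\sum_{k=1}^d\beta_k\,\rho(X_i,\tilde x;\eta_k)},\qquad \bar p_j(\theta)=\mathbb{E}_{\bar\mu}\big[\bar\pi_\theta(j\mid I,\tilde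 X)\big],$$ $$\bar{\mathbf{s}}_j(\theta)=\mathbb{E}_{\bar\mu}\Big[\bar\pi_\theta(j\mid I,\tilde X)\int\mathbf{s}(X_I,\tilde X,\mathbf{u})\,\bar\rho(\mathbf{u}\mid X_I,\tilde X;\eta_j)\,d\mathbf{u}\Big].$$ Write $\bar{\mathbf{p}}(\theta)=(\bar p_1(\theta),\dots,\bar p_d(\theta))^\top$ and $\bar{\mathbf{s}}(\theta)=\bar{\mathbf{s}}_1(\theta)\oplus\cdots\oplus\bar{\mathbf{s}}_d(\theta)$, where $\oplus$ is the block-diagonal direct sum of matrices; a tuple $(\mathbf{s}_1,\dots,\mathbf{s}_d)$ is identified with the direct sum $\mathbf{s}_1\oplus\cdots\oplus\mathbf{s}_d$. **The function $l$.** For $\mathbf{s}=(\mathbf{s}_1,\dots,\mathbf{s}_d)$ and $\mathbf{p}=(p_1,\dots,p_d)^\top$, $$l(\mathbf{s},\mathbf{p};\theta)=-\sum_{j=1}^d a(\eta_j)p_j+\sum_{j=1}^d p_j\log\beta_j+\sum_{j=1}^d\mathrm{Tr}(\mathbf{b}(\eta_j)^\top\mathbf{s}_j).$$ **Mean field.** With $\bar\theta(\mathbf{s},\mathbf{p})$ the maximiser of $l(\mathbf{s},\mathbf{p};\cdot)$ over $\Theta$, $$\mathbf{h}(\mathbf{s},\mathbf{p})=\bar{\mathbf{s}}(\bar\theta(\mathbf{s},\mathbf{p}))\oplus\bar{\mathbf{p}}(\bar\theta(\mathbf{s},\mathbf{p}))-\mathbf{s}\oplus\mathbf{p}.$$ A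 root of $\mathbf{h}$ is a pair $(\mathbf{s},\mathbf{p})$ with $\mathbf{h}(\mathbf{s},\mathbf{p})=\mathbf{0}$.
   Formalization: Added: Θ relatively open in simplex × (R^q)^d, q≥1; a, b differentiable; s̄_j integrands integrable; d_KL differentiable at positive weights; gradients taken along Θ; in (ii), (s*,p* ) lies in Σ^d×Π and l's only stationary point is its maximum (false otherwise, e.g. u~N(η³,1)). *)

(* Defs.v *)
From HB Require Import structures.
From mathcomp Require Import all_boot all_order all_algebra.
From mathcomp Require Import all_classical all_reals all_analysis.

Set Implicit Arguments.
Unset Strict Implicit.
Unset Printing Implicit Defensive.

Import Order.TTheory GRing.Theory Num.Theory.
Import numFieldNormedType.Exports.

Local Open Scope classical_set_scope.
Local Open Scope ring_scope.

(* R^n with the product of the Borel sigma-algebras of its coordinates *)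
Notation Rn R n := (n.-tuple (measurableTypeR R)).

Section lebesgue_n.
Variable R : realType.

Definition consn n (z : measurableTypeR R * Rn R n) : Rn R n.+1 :=
  [the n.+1.-tuple _ of z.1 :: z.2].

Lemma measurable_consn n : measurable_fun [set: _] (@consn n).
Proof.
by apply: measurable_cons; [exact: measurable_fst|exact: measurable_snd].
Qed.

Definition unconsn n (t : Rn R n.+1) : measurableTypeR R * Rn R n :=
  (thead t, [tuple of behead t]).

Lemma measurable_unconsn n : measurable_fun [set: _] (@unconsn n).
Proof.
by apply: measurable_fun_pair; [exact: measurable_tnth|exact: measurable_behead].
Qed.

Lemma consnK n : cancel (@consn n) (@unconsn n).
Proof. by move=> [x t]; congr pair; exact: val_inj. Qed.

Section lebesgue_step.
Variables (n : nat) (mu : {sigma_finite_measure set (Rn R n) -> \bar R}).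

Let prod_mu : {measure set (measurableTypeR R * Rn R n)%type -> \bar R} :=
  (@lebesgue_measure R \x mu)%E.

Definition lebesgue_step : set (Rn R n.+1) -> \bar R :=
  pushforward prod_mu (@consn n).

Let lebesgue_step0 : lebesgue_step set0 = 0%E.
Proof. by rewrite /lebesgue_step /pushforward preimage_set0 measure0. Qed.

Let lebesgue_step_ge0 A : (0 <= lebesgue_step A)%E.
Proof. exact: (measure_ge0 prod_mu). Qed.

Let lebesgue_step_sigma_additive : semi_sigma_additive lebesgue_step.
Proof.
move=> F mF tF mUF; rewrite /lebesgue_step /pushforward preimage_bigcup.
apply: measure_semi_sigma_additive.
- by move=> k; rewrite -[X in measurable X]setTI; exact: measurable_consn.
- apply/trivIsetP => /= i j _ _ ij; rewrite -preimage_setI.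
  by move/trivIsetP : tF => /(_ _ _ _ _ ij) ->//; rewrite preimage_set0.
- by rewrite -preimage_bigcup -[X in measurable X]setTI; exact: measurable_consn.
Qed.

HB.instance Definition _ := isMeasure.Build _ _ _ lebesgue_step
  lebesgue_step0 lebesgue_step_ge0 lebesgue_step_sigma_additive.

Let lebesgue_step_sigma_finite : sigma_finite setT lebesgue_step.
Proof.
have /sigma_finiteP[F [TF ndF Foo]] := sigma_finiteT (@lebesgue_measure R).
have /sigma_finiteP[G [TG ndG Goo]] := sigma_finiteT mu.
exists (fun k => @unconsn n @^-1` (F k `*` G k)).
  rewrite -preimage_bigcup (_ : \bigcup_k _ = setT) ?preimage_setT//.
  rewrite -subTset => -[x y] _.
  have [k _ Fkx] : (\bigcup_k F k) x by rewrite -TF.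
  have [l _ Gly] : (\bigcup_k G k) y by rewrite -TG.
  exists (maxn k l) => //; split => /=.
  - by move: x Fkx; exact/subsetPset/ndF/leq_maxl.
  - by move: y Gly; exact/subsetPset/ndG/leq_maxr.
move=> k; have [mF Fk] := Foo k; have [mG Gk] := Goo k; split.
  rewrite -[X in measurable X]setTI; apply: measurable_unconsn => //.
  exact: measurableX.
rewrite /lebesgue_step /pushforward.
have -> : @consn n @^-1` (@unconsn n @^-1` (F k `*` G k)) = F k `*` G k.
  by apply/funext => z; rewrite /preimage /mkset consnK.
by rewrite /prod_mu /= product_measure1E// lte_mul_pinfty// ge0_fin_numE.
Qed.

HB.instance Definition _ := Measure_isSigmaFinite.Build _ _ _ lebesgue_step
  lebesgue_step_sigma_finite.

End lebesgue_step.

(* n-dimensional Lebesgue measure: the n-fold product of the one-dimensional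
   one *)
Fixpoint lebesgue_n n : {sigma_finite_measure set (Rn R n) -> \bar R} :=
  match n with
  | 0%N => \d_([tuple] : Rn R 0)
  | k.+1 => lebesgue_step (lebesgue_n k)
  end.

End lebesgue_n.

(* Fixed data of the problem.  The parameter eta of a stratum is a row vector
   of R^q, [eta_dom] being the set of admissible ones; theta is encoded as
   (beta, eta), where eta_j is the j-th row of the second component. *)
Record mixture_model (R : realType) (p pt u q m m' N d : nat) := MixtureModel {
  ell : Rn R p -> Rn R pt -> R ;
  ancestor : 'I_N -> Rn R p ;
  omega : 'I_N -> R ;
  psi : Rn R p -> R ;
  rho : Rn R p -> Rn R pt -> 'rV[R]_q -> R ;
  eta_dom : set 'rV[R]_q ;
  Upsilon : set (Rn R u) ;
  gamma : Rn R u -> R ;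
  h0 : Rn R p -> Rn R pt -> Rn R u -> R ;
  suff : Rn R p -> Rn R pt -> Rn R u -> 'M[R]_(m, m') ;
  afun : 'rV[R]_q -> R ;
  bfun : 'rV[R]_q -> 'M[R]_(m, m') ;
  Theta : set ('rV[R]_d * 'M[R]_(d, q))%type
}.

Section gradients.
Variables (R : realType) (d q : nat).
Notation param := ('rV[R]_d * 'M[R]_(d, q))%type.
Implicit Types (T : set param) (f : param -> \bar R) (th g : param).

Definition param_dot g th : R :=
  \sum_j g.1 0 j * th.1 0 j + \sum_j \sum_k g.2 j k * th.2 j k.

(* f is finite at th and f th' = f th + <g, th' - th> + o(|th' - th|) when th'
   tends to th inside T; in particular f is finite on T near th.  As the weights
   sum to one on T, g is determined only up to a multiple of (1, ..., 1) in its
   weight component. *)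
Definition has_gradient_in T f th g :=
  f th \is a fin_num /\
  forall e : R, 0 < e -> \forall th' \near within T (nbhs th),
    (`|f th' - f th - (param_dot g (th' - th))%:E| <= (e * `|th' - th|)%:E)%E.

Definition differentiable_in T f th := exists g, has_gradient_in T f th g.

Definition stationary_in T f th := T th /\ has_gradient_in T f th 0.

Definition unique_max_in T f th :=
  [/\ T th, forall th', T th' -> (f th' <= f th)%E
    & forall th', T th' -> (forall th'', T th'' -> (f th'' <= f th')%E) ->
      th' = th].

Definition simplex_params : set param :=
  [set th : param | (forall j, 0 <= th.1 0 j) /\ \sum_j th.1 0 j = 1].

End gradients.

Section model.
Variables (R : realType) (p pt u q m m' N d : nat).
Variable M : mixture_model R p pt u q m m' N d.
Notation param := ('rV[R]_d * 'M[R]_(d, q))%type.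
Implicit Types (x : Rn R p) (xt : Rn R pt) (v : Rn R u) (eta : 'rV[R]_q).
Implicit Types (th : param) (i : 'I_N) (j : 'I_d).

Definition weight th j : R := th.1 0 j.
Definition stratum th j : 'rV[R]_q := row j th.2.

Definition rhobar x xt v eta : R :=
  gamma M v * h0 M x xt v *
  expR (- afun M eta + \tr ((bfun M eta)^T *m suff M x xt v)).

Record integrated_curved_exponential : Prop := {
  Upsilon_measurable : measurable (Upsilon M) ;
  gamma_measurable : measurable_fun (Upsilon M) (gamma M) ;
  h0_measurable : measurable_fun (setT `*` Upsilon M)
    (fun z : (Rn R p * Rn R pt) * Rn R u => h0 M z.1.1 z.1.2 z.2) ;
  suff_measurable : forall k l, measurable_fun (setT `*` Upsilon M)
    (fun z : (Rn R p * Rn R pt) * Rn R u => suff M z.1.1 z.1.2 z.2 k l) ;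
  rhobar_ge0 : forall x xt v eta, eta_dom M eta -> Upsilon M v ->
    0 <= rhobar x xt v eta ;
  rhobar_markov : forall x eta, eta_dom M eta ->
    (\int[(lebesgue_n R pt \x lebesgue_n R u)%E]_(z in setT `*` Upsilon M)
       (rhobar x z.1 z.2 eta)%:E = 1)%E ;
  rho_marginal : forall x xt eta, eta_dom M eta ->
    ((rho M x xt eta)%:E =
     \int[lebesgue_n R u]_(v in Upsilon M) (rhobar x xt v eta)%:E)%E
}.

Definition cond_density x xt eta v : R := rhobar x xt v eta / rho M x xt eta.

(* "The conditional expectation is available in closed form": the mathematical
   content is that it exists. *)
Definition cond_expect_defined := forall x xt eta, eta_dom M eta ->
  forall k l, (lebesgue_n R u).-integrable (Upsilon M)
    (fun v => (suff M x xt v k l * cond_density x xt eta v)%:E).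

Definition cond_expect x xt eta : 'M[R]_(m, m') :=
  \matrix_(k, l) \int[lebesgue_n R u]_(v in Upsilon M)
    (suff M x xt v k l * cond_density x xt eta v).

Definition total_mass : R :=
  \sum_(i < N) omega M i * \int[lebesgue_n R pt]_xt ell M (ancestor M i) xt.

Definition mubar i xt : R := omega M i * ell M (ancestor M i) xt / total_mass.

Definition Emubar (f : 'I_N -> Rn R pt -> R) : \bar R :=
  (\sum_(i < N) \int[lebesgue_n R pt]_xt (mubar i xt * f i xt)%:E)%E.

Definition mixture th x xt : R := \sum_j weight th j * rho M x xt (stratum th j).

Definition proposal th i xt : R :=
  omega M i * psi M (ancestor M i) /
    (\sum_(k < N) omega M k * psi M (ancestor M k)) *
  mixture th (ancestor M i) xt.

Definition dKL th : \bar R :=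
  Emubar (fun i xt => ln (mubar i xt / proposal th i xt)).

Definition resp th j i xt : R :=
  weight th j * rho M (ancestor M i) xt (stratum th j) /
  mixture th (ancestor M i) xt.

Definition resp_stat th j k l i xt : R :=
  resp th j i xt * cond_expect (ancestor M i) xt (stratum th j) k l.

Definition pbar th : 'cV[R]_d := \col_j fine (Emubar (resp th j)).

Definition sbar th j : 'M[R]_(m, m') :=
  \matrix_(k, l) fine (Emubar (resp_stat th j k l)).

(* [lne 0 = -oo] and [0 * -oo = 0] *)
Definition lfun (s : 'I_d -> 'M[R]_(m, m')) (pv : 'cV[R]_d) th : \bar R :=
  (- \sum_j (afun M (stratum th j) * pv j 0)%:E
   + \sum_j (pv j 0)%:E * lne (weight th j)%:E
   + \sum_j (\tr ((bfun M (stratum th j))^T *m s j))%:E)%E.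

Definition direct_sum (s : 'I_d -> 'M[R]_(m, m')) :
    'M[R]_(\sum_(j < d) m, \sum_(j < d) m') :=
  \mxblock_(j < d, k < d) (if j == k then s j else 0).

Definition direct_sum_weights (s : 'I_d -> 'M[R]_(m, m')) (pv : 'cV[R]_d) :=
  block_mx (direct_sum s) 0 0 pv.

Definition mean_field (thetabar : ('I_d -> 'M[R]_(m, m')) -> 'cV[R]_d -> param)
    (s : 'I_d -> 'M[R]_(m, m')) (pv : 'cV[R]_d) :=
  direct_sum_weights (sbar (thetabar s pv)) (pbar (thetabar s pv))
  - direct_sum_weights s pv.

Record standing_assumptions : Prop := {
  ell_measurable : measurable_fun setT
    (fun z : Rn R p * Rn R pt => ell M z.1 z.2) ;
  ell_ge0 : forall x xt, 0 <= ell M x xt ;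
  ell_integrable : forall x,
    (lebesgue_n R pt).-integrable setT (fun xt => (ell M x xt)%:E) ;
  omega_ge0 : forall i, 0 <= omega M i ;
  psi_gt0 : forall x, 0 < psi M x ;
  total_mass_gt0 : 0 < total_mass ;
  Theta_simplex : Theta M `<=` @simplex_params R d q ;
  Theta_eta_dom : forall th j, Theta M th -> eta_dom M (stratum th j) ;
  proposal_dominates : forall th x xt, Theta M th ->
    mixture th x xt = 0 -> ell M x xt = 0
}.

(* What the gradients and the expected statistics need in order to make sense.
   Differentiability of dKL is only asked for at positive weights, where Theta
   is a neighbourhood relative to the hyperplane of weights summing to one. *)
Record regularity : Prop := {
  Theta_open : exists2 U : set param, open U &
    Theta M = U `&` @simplex_params R d q ;
  afun_differentiable : forall eta, eta_dom M eta ->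
    differentiable (afun M) (nbhs eta) ;
  bfun_differentiable : forall eta, eta_dom M eta ->
    differentiable (bfun M) (nbhs eta) ;
  stat_integrable : forall th j k l i, Theta M th ->
    (lebesgue_n R pt).-integrable setT
      (fun xt => (mubar i xt * resp_stat th j k l i xt)%:E) ;
  dKL_differentiable : forall th, Theta M th -> (forall j, 0 < weight th j) ->
    differentiable_in (Theta M) dKL th
}.

End model.

(* Main.v *)
Require Import Defs.
From mathcomp Require Import all_boot all_order all_algebra.
From mathcomp Require Import all_classical all_reals all_analysis.
From mathcomp Require Import measurable_realfun ring lra.

(* This is the minorization argument behind the EM algorithm.  Applying Jensen's
   inequality twice, to the conditional law of u inside each stratum and to the
   responsibilities, shows that, for fixed th,
     th' |-> l(sbar th, pbar th; th') + dKL th'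
   is maximal at th' = th.  At positive weights both summands are differentiable
   along Theta and their gradients cancel on the directions tangent to the
   simplex, so that th is stationary for dKL iff it is stationary for
   l(sbar th, pbar th; .).  A stratum of weight zero would have p_j = 0 and
   s_j = 0, so that l would not depend on eta_j, against the uniqueness of the
   maximum: all the weights are positive. *)

Set Implicit Arguments.
Unset Strict Implicit.
Unset Printing Implicit Defensive.

Import Order.TTheory GRing.Theory Num.Theory.
Import numFieldNormedType.Exports.

Local Open Scope classical_set_scope.
Local Open Scope ring_scope.

(** * Gradients along a relatively open part of the simplex *)

Section gradient_calculus.
Variables (R : realType) (d q : nat).
Notation param := ('rV[R]_d * 'M[R]_(d, q))%type.
Implicit Types (T : set param) (f : param -> \bar R) (th g v : param).

Lemma param_dotD g1 g2 v :
  param_dot (g1 + g2) v = param_dot g1 v + param_dot g2 v.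
Proof.
rewrite /param_dot addrACA; congr (_ + _).
  by rewrite -big_split; apply: eq_bigr => j _ /=; rewrite mxE mulrDl.
rewrite -big_split; apply: eq_bigr => j _ /=.
by rewrite -big_split; apply: eq_bigr => k _ /=; rewrite mxE mulrDl.
Qed.

Lemma param_dotZr g (t : R) v : param_dot g (t *: v) = t * param_dot g v.
Proof.
rewrite /param_dot mulrDr !mulr_sumr; congr (_ + _); apply: eq_bigr => j _ /=.
  by rewrite mxE mulrCA.
by rewrite mulr_sumr; apply: eq_bigr => k _ /=; rewrite mxE mulrCA.
Qed.

Lemma param_dot0l v : param_dot 0 v = 0.
Proof. by apply: (addrI (param_dot 0 v)); rewrite -param_dotD !addr0. Qed.

(** The coordinates of [g] are the values of [D] on the canonical basis, so that a differential can
    be read as a gradient. *)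
Lemma linear_param_dot (D : {linear param -> R}) : exists g, D =1 param_dot g.
Proof.
exists (\row_j D (delta_mx 0 j, 0), \matrix_(j, k) D (0, delta_mx j k)) => v.
have {1}-> : v = \sum_j v.1 0 j *: ((delta_mx 0 j, 0) : param) +
    \sum_j \sum_k v.2 j k *: ((0, delta_mx j k) : param).
  rewrite [LHS]surjective_pairing [RHS]surjective_pairing; congr pair.
    rewrite {1}[v.1]row_sum_delta /= !raddf_sum/=.
    rewrite [X in _ = _ + X]big1 ?addr0 //.
    move=> j _; rewrite raddf_sum/= big1// => k _.
    by rewrite scaler0.
  rewrite {1}[v.2]matrix_sum_delta /= !raddf_sum/= [X in _ = X + _]big1 ?add0r.
    by apply: eq_bigr => j _; rewrite raddf_sum.
  by move=> j _; rewrite scaler0.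
rewrite linearD !linear_sum/= /param_dot; congr (_ + _); apply: eq_bigr => j _.
  by rewrite linearZ/= mxE mulrC.
by rewrite linear_sum; apply: eq_bigr => k _; rewrite linearZ/= mxE mulrC.
Qed.

(** A finite bound on the extended-real error already forces [f th'] to be finite, so the expansion
    can be handled with real numbers. *)
Lemma has_gradient_inP T f th g : has_gradient_in T f th g <->
  f th \is a fin_num /\
  forall e : R, 0 < e -> \forall th' \near within T (nbhs th),
    f th' \is a fin_num /\
    `|fine (f th') - fine (f th) - param_dot g (th' - th)| <= e * `|th' - th|.
Proof.
split=> -[ffin H]; split=> // e e0; move: (H _ e0); apply: filter_app;
  apply: nearW => th' _.
- rewrite -(fineK ffin); case: (f th') => [r| |]//=.
- by move=> [f'fin]; rewrite -(fineK ffin) -(fineK f'fin)/=.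
Qed.

Lemma has_gradient_near_fin T f th g : has_gradient_in T f th g ->
  \forall th' \near within T (nbhs th), f th' \is a fin_num.
Proof.
by move=> /has_gradient_inP[_ /(_ 1 ltr01)]; apply: filterS => th' [].
Qed.

Lemma has_gradient_inD T f1 f2 th g1 g2 :
  has_gradient_in T f1 th g1 -> has_gradient_in T f2 th g2 ->
  has_gradient_in T (f1 \+ f2)%E th (g1 + g2).
Proof.
move=> /has_gradient_inP[fin1 H1] /has_gradient_inP[fin2 H2].
apply/has_gradient_inP; split=> [|e e0]; first by rewrite fin_numD fin1.
have e20 : 0 < e / 2 by rewrite divr_gt0.
move: (H1 _ e20) (H2 _ e20); apply: filterS2 => th' [fin1' H1'] [fin2' H2'].
split; first by rewrite fin_numD fin1'.
rewrite !fineD// param_dotD [e]splitr mulrDl.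
apply: le_trans (lerD H1' H2'); apply: le_trans (ler_normD _ _).
by rewrite le_eqVlt; apply/orP; left; apply/eqP; congr `|_|; ring.
Qed.

(** Displacements inside the simplex have weight components summing to zero, so only the values of
    [g] on these tangent directions enter the expansion. *)
Lemma has_gradient_in0 T f th g : T `<=` @simplex_params R d q -> T th ->
  (forall v, \sum_j v.1 0 j = 0 -> param_dot g v = 0) ->
  has_gradient_in T f th g -> has_gradient_in T f th 0.
Proof.
move=> TS Tth g0 [ffin H]; split=> // e e0.
move: (H _ e0); rewrite !near_withinE.
apply: filterS => th' + Tth' => /(_ Tth').
rewrite param_dot0l g0//.
under eq_bigr do rewrite !mxE.
by rewrite sumrB (TS _ Tth).2 (TS _ Tth').2 subrr.
Qed.

Lemma near_weight_gt0 th : (forall j, 0 < th.1 0 j) ->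
  nbhs th (fun th' : param => forall j, 0 < th'.1 0 j).
Proof.
move=> th0; apply: (filter_forall (F := nbhs th)
  (f := fun j (th' : param) => 0 < th'.1 0 j)) => j.
apply: (@cvgr_gt _ _ _ _ (fun th' : param => th'.1 0 j) (th.1 0 j)) => //.
apply: (@continuous_comp _ _ _ fst (fun x : 'rV[R]_d => x 0 j)).
  exact: cvg_fst.
exact: coord_continuous.
Qed.

Lemma cvg_line th v : (fun t : R => th + t *: v) @ (0 : R)^'+ --> th.
Proof.
rewrite -[X in _ --> X]addr0 -(scale0r v).
apply: cvg_at_right_filter; apply: cvgD; first exact: cvg_cst.
by apply: cvgZr_tmp; exact: cvg_id.
Qed.

(** At positive weights the sign constraints hold in a whole neighbourhood; only the hyperplane
    equation remains, and a tangent direction preserves it. Short segments from [th] along [v] thus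
    stay in the domain. *)
Lemma near_simplex_line (U : set param) th v : open U ->
  U th -> @simplex_params R d q th -> (forall j, 0 < th.1 0 j) ->
  \sum_j v.1 0 j = 0 -> forall P : set param,
  (\forall th' \near within (U `&` @simplex_params R d q) (nbhs th), P th') ->
  \forall t \near (0 : R)^'+, P (th + t *: v).
Proof.
move=> oU Uth Sth th0 v0 P HP.
have {}HP : nbhs th (fun th' : param => \sum_j th'.1 0 j = 1 -> P th').
  move: HP; rewrite near_withinE.
  move: (near_weight_gt0 th0) (open_nbhs_nbhs (conj oU Uth)).
  apply: filterS3 => th' th'0 Uth' H S'; apply: H; split=> //.
  by split=> // j; apply/ltW.
have := cvg_line v HP; rewrite nbhs_simpl/=; apply: filterS => t /=; apply.
rewrite (eq_bigr (fun j => th.1 0 j + t * v.1 0 j)); last first.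
  by move=> j _; rewrite !mxE.
by rewrite big_split/= Sth.2 -mulr_sumr v0 mulr0 addr0.
Qed.

(** Fermat's rule on the relative interior of the simplex. *)
Lemma local_max_gradient (U : set param) f th g v : open U ->
  U th -> @simplex_params R d q th -> (forall j, 0 < th.1 0 j) ->
  has_gradient_in (U `&` @simplex_params R d q) f th g ->
  (\forall th' \near within (U `&` @simplex_params R d q) (nbhs th),
     (f th' <= f th)%E) ->
  \sum_j v.1 0 j = 0 -> param_dot g v = 0.
Proof.
move=> oU Uth Sth th0 /has_gradient_inP[ffin fg] fmax.
(* The opposite of a tangent direction is tangent, so one inequality suffices. *)
suff dot_le0 (w : param) : \sum_j w.1 0 j = 0 -> param_dot g w <= 0.
  move=> v0; apply/eqP; rewrite eq_le dot_le0//=.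
  rewrite -oppr_le0 -mulN1r -param_dotZr dot_le0//=.
  by under eq_bigr do rewrite !mxE mulN1r; rewrite sumrN v0 oppr0.
move=> w0; rewrite leNgt; apply/negP => c0.
set c := param_dot g w in c0.
have w1 : 0 < `|w| + 1 by rewrite ltr_wpDl.
(* With this tolerance the error at [th + t *: w] is at most [t * c * |w| / (|w| + 1)], strictly
   below the first-order gain [t * c]. *)
have e0 : 0 < c / (`|w| + 1) by rewrite divr_gt0.
have [t [[[f'fin fgt] fmaxt] t0]] := filter_ex (filterI
  (near_simplex_line oU Uth Sth th0 w0 (filterI (fg _ e0) fmax))
  (nbhs_right_gt (0 : R))).
move: fmaxt fgt; rewrite -(fineK ffin) -(fineK f'fin) lee_fin/= => fmaxt.
have -> : th + t *: w - th = t *: w by rewrite addrC addKr.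
rewrite param_dotZr -/c normrZ (gtr0_norm t0) ler_norml => /andP[+ _].
apply/negP; rewrite -ltNge.
have : c / (`|w| + 1) * (t * `|w|) < t * c.
  rewrite mulrAC ltr_pdivrMr// mulrCA mulrA ltr_pM2l ?mulr_gt0// ?ltrDl//.
lra.
Qed.

End gradient_calculus.

(** * From differentiability to gradients along a set *)

Section differentiability.
Variables (R : realType) (d q : nat).
Notation param := ('rV[R]_d * 'M[R]_(d, q))%type.
Implicit Types (T : set param) (f : param -> \bar R) (th g v : param).

Lemma differentiable_gradient T f (F : param -> R) th : differentiable F th ->
  (nbhs th (fun th' => f th' = (F th')%:E)) -> differentiable_in T f th.
Proof.
move=> dF fF; have [g Hg] := linear_param_dot ('d F th).
exists g; apply/has_gradient_inP; have fthE := nbhs_singleton fF.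
split=> [|e e0]; first by rewrite fthE.
have H : nbhs th (fun th' =>
    `|F th' - F th - param_dot g (th' - th)| <= e * `|th' - th|).
  apply/(@nbhs0P R param); have /eqaddoP/(_ _ e0) := diff_locally dF.
  apply: filterS => v.
  rewrite -![(_ + _ : _ -> _) _]/(_ + _) -![(- _ : _ -> _) _]/(- _) /=.
  by rewrite -Hg opprD addrA (addrC th) addrK.
rewrite near_withinE; move: H fF.
apply: (filterS2 (F := nbhs th)) => th' H fth' _.
by split; rewrite fth' ?fthE.
Qed.

Lemma differentiable_row (p : nat) (j : 'I_p) (A : 'M[R]_(p, q)) :
  differentiable (fun B : 'M[R]_(p, q) => row j B) A.
Proof.
apply: linear_differentiable => B s /= /nbhs_ballP[e e0 es].
apply/nbhs_ballP; exists e => //= C [_ BC]; apply: es; split=> // i k.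
by rewrite !mxE; exact: BC.
Qed.

Lemma differentiable_snd th : differentiable (snd : param -> 'M[R]_(d, q)) th.
Proof. by apply: linear_differentiable => x; exact: cvg_snd. Qed.

Lemma differentiable_fst th : differentiable (fst : param -> 'rV[R]_d) th.
Proof. by apply: linear_differentiable => x; exact: cvg_fst. Qed.

End differentiability.

(** * Differentiability of l at positive weights *)

Section lfun.
Variables (R : realType) (p pt u q m m' N d : nat).
Variable M : mixture_model R p pt u q m m' N d.
Notation param := ('rV[R]_d * 'M[R]_(d, q))%type.
Implicit Types (th : param) (s : 'I_d -> 'M[R]_(m, m')) (pv : 'cV[R]_d).

Lemma mxtrace_trmx_mul (a b : 'M[R]_(m, m')) :
  \tr (a^T *m b) = \sum_k \sum_l a k l * b k l.
Proof.
rewrite /mxtrace exchange_big; apply: eq_bigr => l _; rewrite mxE.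
by apply: eq_bigr => k _; rewrite mxE.
Qed.

(** Real-valued form of l, grouped by stratum and with traces expanded into entries; it is meant for
    positive weights, where the extended logarithm is finite. *)
Definition lfun_real s pv th : R :=
  \sum_j (pv j 0 * (ln (weight th j) - afun M (stratum th j)) +
          \sum_k \sum_l bfun M (stratum th j) k l * s j k l).

Lemma lfunE s pv th : (forall j, 0 < weight th j) ->
  lfun M s pv th = (lfun_real s pv th)%:E.
Proof.
move=> th0; rewrite /lfun /lfun_real.
under [X in (_ + X + _)%E]eq_bigr do rewrite lne_EFin// -EFinM.
rewrite !sumEFin -EFinN -!EFinD -sumrN -!big_split/=; congr EFin.
apply: eq_bigr => j _; rewrite mxtrace_trmx_mul; congr (_ + _); ring.
Qed.

Lemma lfun_differentiable s pv th : regularity M ->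
  Theta M th -> (forall j, eta_dom M (stratum th j)) ->
  (forall j, 0 < weight th j) -> differentiable_in (Theta M) (lfun M s pv) th.
Proof.
move=> reg Tth eth th0.
apply: (@differentiable_gradient _ _ _ _ _ (lfun_real s pv)); last first.
  move: (near_weight_gt0 th0); apply: filterS => th'; exact: lfunE.
have dstr j : differentiable (fun th' : param => stratum th' j) th.
  apply: (@differentiable_comp _ _ _ _ snd (row j)).
    exact: differentiable_snd.
  exact: differentiable_row.
have -> : lfun_real s pv = \sum_j (fun th =>
  (pv j 0 * (ln (weight th j) - afun M (stratum th j)) +
          \sum_k \sum_l bfun M (stratum th j) k l * s j k l)).
  by apply/funext => th'; rewrite fct_sumE.
apply: differentiable_sum => j.
apply: differentiableD.
  apply: differentiableM; first exact: differentiable_cst.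
  apply: differentiableB.
    apply: (@differentiable_comp _ _ _ _
      (fun th' : param => weight th' j) (@ln R)).
      apply: (@differentiable_comp _ _ _ _ fst (fun x : 'rV[R]_d => x 0 j)).
        exact: differentiable_fst.
      exact: differentiable_coord.
    apply/derivable1_diffP; apply: ex_derive; exact: is_derive1_ln.
  apply: (@differentiable_comp _ _ _ _
    (fun th' : param => stratum th' j) (afun M)) => //.
  exact: afun_differentiable.
have -> : (fun th' : param =>
      \sum_k \sum_l bfun M (stratum th' j) k l * s j k l) =
    \sum_k \sum_l (fun th' : param => bfun M (stratum th' j) k l * s j k l).
  apply/funext => th'; rewrite fct_sumE; apply: eq_bigr => k _.
  by rewrite fct_sumE.
apply: differentiable_sum => k; apply: differentiable_sum => l.
apply: differentiableM; last exact: differentiable_cst.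
apply: (@differentiable_comp _ _ _ _
  (fun th' : param => bfun M (stratum th' j))
  (fun x : 'M[R]_(m, m') => x k l)).
  apply: (@differentiable_comp _ _ _ _
    (fun th' : param => stratum th' j) (bfun M)) => //.
  exact: bfun_differentiable.
exact: differentiable_coord.
Qed.

End lfun.

(** * Minorization of the divergence *)

Section lemmas.
Context d (T : measurableType d) (R : realType).
Context (mu : {measure set T -> \bar R}).

Lemma integrable_lincomb (I : finType) D (k : I -> R) (f : I -> T -> R) :
  measurable D -> (forall i, mu.-integrable D (EFin \o f i)) ->
  mu.-integrable D (EFin \o (fun x => \sum_i k i * f i x)).
Proof.
move=> mD fi.
have -> : EFin \o (fun x => \sum_i k i * f i x) =
    fun x => (\sum_i (k i)%:E * (EFin \o f i) x)%E.
  by apply/funext => x /=; rewrite -sumEFin.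
by apply: integrable_sum => // i _; exact: integrableZl.
Qed.

Lemma Rintegral_lincomb (I : finType) D (k : I -> R) (f : I -> T -> R) :
  measurable D -> (forall i, mu.-integrable D (EFin \o f i)) ->
  \int[mu]_(x in D) (\sum_i k i * f i x) =
  \sum_i k i * \int[mu]_(x in D) f i x.
Proof.
move=> mD fi.
have kfi i : mu.-integrable D (fun x => (k i * f i x)%:E).
  by under eq_fun do rewrite EFinM; exact: integrableZl (fi i).
rewrite /Rintegral; under eq_integral do rewrite -sumEFin.
rewrite integral_sum// -sum_fine; last by move=> i _; exact: integrable_fin_num.
by apply: eq_bigr => i _; rewrite -[RHS]RintegralZl.
Qed.

(** The integral is the difference of those of the positive and negative parts, and [+oo - +oo] is
    [-oo]: it is finite only if both are. *)
Lemma fin_num_integrable D (f : T -> R) :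
  measurable D -> measurable_fun D f ->
  (\int[mu]_(x in D) (f x)%:E)%E \is a fin_num ->
  mu.-integrable D (EFin \o f).
Proof.
move=> mD mf ffin; apply/integrableP; split; first exact/measurable_EFinP.
by rewrite integral_fin_num_abs.
Qed.

(* [x / y] is [x * y `^ (-1)] for [0 <= y], including [y = 0] where both
   vanish. *)
Lemma measurable_fun_div D (f g : T -> R) : measurable_fun D f ->
  measurable_fun D g -> (forall x, 0 <= g x) ->
  measurable_fun D (fun x => f x / g x).
Proof.
move=> mf mg g0; under eq_fun do rewrite -powR_inv1//.
apply: measurable_funM => //.
apply: (measurableT_comp (f := fun y : R => y `^ (-1))) => //.
Qed.

End lemmas.

(** * Jensen's inequality for finite sums *)

Section ln_sum.
Variables (R : realType) (I : finType).

(** Convexity of the exponential: its graph lies above the tangent at [c]. *)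
Lemma expR_tangent (c x : R) : expR c * (1 + (x - c)) <= expR x.
Proof.
rewrite -[in leRHS](subrK c x) addrC [in leRHS]addrC expRD.
rewrite ler_pM2l ?expR_gt0//; apply: le_trans (expR_ge1Dx _).
by rewrite addrC.
Qed.

(** Jensen's inequality for the probability weights [r i / S]: each [expR (c i)] is bounded below by
    the tangent at the weighted mean [C] of the [c i]. *)
Lemma ln_ratio_ge (r r' c : I -> R) : (forall i, 0 <= r i) ->
  0 < \sum_i r i -> (forall i, r i * expR (c i) <= r' i) ->
  \sum_i r i / (\sum_i r i) * c i <= ln ((\sum_i r' i) / \sum_i r i).
Proof.
move=> r0 S0 rr'; set S := \sum_i r i in S0 *.
set C := \sum_i _.
have le1 : S * expR C <= \sum_i r' i.
  apply: le_trans (ler_sum _ (fun i _ => rr' i)).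
  apply: (@le_trans _ _ (\sum_i r i * (expR C * (1 + (c i - C))))); last first.
    by apply: ler_sum => i _; apply: ler_wpM2l => //; exact: expR_tangent.
  (* The deviations [c i - C] average to zero, so the linear terms cancel. *)
  rewrite le_eqVlt; apply/orP; left; apply/eqP.
  have SC : \sum_i r i * c i = S * C.
    rewrite mulr_sumr; apply: eq_bigr => i _.
    by rewrite mulrA mulrCA divff ?gt_eqF// mulr1.
  under eq_bigr do rewrite mulrCA mulrDr mulrBr mulr1.
  by rewrite -mulr_sumr big_split sumrB/= SC -mulr_suml -/S subrr addr0 mulrC.
rewrite -ler_expR lnK ?posrE.
  by rewrite ler_pdivlMr// mulrC.
by rewrite divr_gt0// (lt_le_trans _ le1)// mulr_gt0 ?expR_gt0.
Qed.

End ln_sum.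

(** * Jensen's inequality for the mixture model *)

Section jensen.
Variables (R : realType) (p pt u q m m' N d : nat).
Variable M : mixture_model R p pt u q m m' N d.
Notation param := ('rV[R]_d * 'M[R]_(d, q))%type.
Implicit Types (x : Rn R p) (xt : Rn R pt) (v : Rn R u) (eta : 'rV[R]_q).
Implicit Types (th : param) (i : 'I_N) (j : 'I_d).
Hypothesis standing : standing_assumptions M.
Hypothesis A1 : integrated_curved_exponential M.
Hypothesis A2 : cond_expect_defined M.

Let mUpsilon := Upsilon_measurable A1.

Lemma measurable_rhobar x eta : measurable_fun (setT `*` Upsilon M)
  (fun z : Rn R pt * Rn R u => rhobar M x z.1 z.2 eta).
Proof.
pose g (z : Rn R pt * Rn R u) : (Rn R p * Rn R pt) * Rn R u := ((x, z.1), z.2).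
have mg : measurable_fun (setT `*` Upsilon M) g.
  apply: (@measurable_funS _ _ _ _ setT) => //.
  by do !apply: measurable_fun_pair => //.
have mcomp (f : (Rn R p * Rn R pt) * Rn R u -> R) :
    measurable_fun (setT `*` Upsilon M) f ->
    measurable_fun (setT `*` Upsilon M) (f \o g).
  move=> mf; apply: measurable_comp mf mg; first exact: measurableX.
  by move=> _ [z [_ Uz] <-].
apply: measurable_funM; first apply: measurable_funM.
- apply: (measurable_comp mUpsilon _ (gamma_measurable A1)).
    by move=> _ [z [_ Uz] <-].
  exact: measurable_funS measurable_snd.
- exact: (mcomp _ (h0_measurable A1)).
- apply: (measurableT_comp (f := @expR R)) => //.
  under eq_fun do rewrite mxtrace_trmx_mul.
  apply: measurable_funD => //.
  apply: measurable_sum => k; apply: measurable_sum => l.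
  by apply: measurable_funM => //; exact: (mcomp _ (suff_measurable A1 k l)).
Qed.

Lemma measurable_rhobar_section x xt eta :
  measurable_fun (Upsilon M) (fun v => rhobar M x xt v eta).
Proof.
apply: (measurable_comp _ _ (measurable_rhobar x eta) (g := pair xt)).
- exact: measurableX.
- by move=> _ [v Uv <-].
- exact: measurable_funS (pair1_measurable _).
Qed.

(** [rho] is a marginal of [rhobar], so Tonelli's theorem applies once [rhobar] is extended by zero
    outside [Upsilon M]. *)
Lemma measurable_rho x eta : eta_dom M eta ->
  measurable_fun setT (fun xt => rho M x xt eta).
Proof.
move=> eeta; apply/measurable_EFinP.
pose f (z : Rn R pt * Rn R u) : \bar R :=
  ((EFin \o (fun z : Rn R pt * Rn R u => rhobar M x z.1 z.2 eta))
     \_ (setT `*` Upsilon M)) z.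
have -> : EFin \o (fun xt => rho M x xt eta) = fubini_F (lebesgue_n R u) f.
  apply/funext => xt /=; rewrite (rho_marginal A1)// integral_mkcond.
  apply: eq_integral => v _; rewrite /f !patchE.
  suff -> : ((xt, v) \in setT `*` Upsilon M) = (v \in Upsilon M) by [].
  by apply/idP/idP; rewrite !inE => Uv; [case: Uv|split].
apply: (measurable_fun_fubini_tonelli_F (m2 := lebesgue_n R u)) => [|z].
- apply/(measurable_restrictT _ (measurableX measurableT mUpsilon)).
  by apply/measurable_EFinP; exact: measurable_rhobar.
- rewrite /f patchE; case: ifPn => // /[!inE] -[_ Uz].
  by rewrite lee_fin (rhobar_ge0 A1).
Qed.

Lemma rho_ge0 x xt eta : eta_dom M eta -> 0 <= rho M x xt eta.
Proof.
move=> eeta; rewrite -lee_fin (rho_marginal A1)//; apply: integral_ge0 => v Uv.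
by rewrite lee_fin (rhobar_ge0 A1).
Qed.

Lemma rhobar_integrable x xt eta : eta_dom M eta ->
  (lebesgue_n R u).-integrable (Upsilon M)
    (EFin \o (fun v => rhobar M x xt v eta)).
Proof.
move=> eeta; apply: fin_num_integrable => //.
  exact: measurable_rhobar_section.
by rewrite -(rho_marginal A1).
Qed.

Lemma rhoE x xt eta : eta_dom M eta ->
  rho M x xt eta = \int[lebesgue_n R u]_(v in Upsilon M) rhobar M x xt v eta.
Proof. by move=> eeta; rewrite /Rintegral -(rho_marginal A1). Qed.

(* The conditional expectation, given (x, xt) and under eta, of
   log (rhobar(.; eta') / rhobar(.; eta)). *)
Definition stratum_gain x xt eta eta' : R :=
  afun M eta - afun M eta' +
  \sum_k \sum_l (bfun M eta' k l - bfun M eta k l) * cond_expect M x xt eta k l.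

(** Jensen's inequality under the conditional law of u: where [rho] is positive at [eta], the ratio
    of the two values of [rho] is the mean of [expR Delta], and the gain is the mean of [Delta]. *)
Lemma rho_stratum_gain x xt eta eta' : eta_dom M eta -> eta_dom M eta' ->
  rho M x xt eta * expR (stratum_gain x xt eta eta') <= rho M x xt eta'.
Proof.
move=> eeta eeta'.
have := rho_ge0 x xt eeta; rewrite le_eqVlt => /predU1P[<-|rho0].
  by rewrite mul0r rho_ge0.
set c := stratum_gain _ _ _ _.
(* The logarithm of the ratio of the exponential factors; [gamma] and [h0] are common to both
   densities. *)
pose Delta v := afun M eta - afun M eta' +
  \sum_k \sum_l (bfun M eta' k l - bfun M eta k l) * suff M x xt v k l.
have rhobarE v : rhobar M x xt v eta' = rhobar M x xt v eta * expR (Delta v).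
  rewrite /rhobar -[RHS]mulrA -expRD; congr (_ * expR _).
  rewrite !mxtrace_trmx_mul /Delta.
  under [X in _ = _ + (_ + X)]eq_bigr do
    (under eq_bigr do rewrite mulrBl; rewrite sumrB).
  rewrite sumrB; ring.
have Kint : (lebesgue_n R u).-integrable (Upsilon M)
    (EFin \o (fun v => cond_density M x xt eta v)).
  exact: integrableZr (rhobar_integrable x xt eeta).
pose I2 : finType := ('I_m * 'I_m')%type.
have sint (kl : I2) : (lebesgue_n R u).-integrable (Upsilon M)
    (EFin \o (fun v => suff M x xt v kl.1 kl.2 * cond_density M x xt eta v)).
  exact: A2.
(* [rho * e^c * F] is the tangent lower bound at [c] of
   [rhobar(.; eta') = rhobar(.; eta) * e^Delta], and F integrates to 1 by the
   choice of c. *)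
pose F v := (1 - c + (afun M eta - afun M eta')) * cond_density M x xt eta v +
  \sum_(kl : I2) (bfun M eta' kl.1 kl.2 - bfun M eta kl.1 kl.2) *
     (suff M x xt v kl.1 kl.2 * cond_density M x xt eta v).
have F1int : (lebesgue_n R u).-integrable (Upsilon M)
    (EFin \o (fun v =>
       (1 - c + (afun M eta - afun M eta')) * cond_density M x xt eta v)).
  exact: integrableZl Kint.
have F2int := integrable_lincomb (fun kl : I2 =>
  bfun M eta' kl.1 kl.2 - bfun M eta kl.1 kl.2) mUpsilon sint.
have Fint : (lebesgue_n R u).-integrable (Upsilon M) (EFin \o F).
  exact: integrableD F1int F2int.
have IF : \int[lebesgue_n R u]_(v in Upsilon M) F v = 1.
  rewrite RintegralD// RintegralZl// Rintegral_lincomb//.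
  have -> : \int[lebesgue_n R u]_(v in Upsilon M) cond_density M x xt eta v = 1.
    by rewrite RintegralZr ?rhobar_integrable// -rhoE// divff// gt_eqF.
  have -> : \sum_(kl : I2) (bfun M eta' kl.1 kl.2 - bfun M eta kl.1 kl.2) *
     \int[lebesgue_n R u]_(v in Upsilon M)
       (suff M x xt v kl.1 kl.2 * cond_density M x xt eta v) =
     \sum_k \sum_l (bfun M eta' k l - bfun M eta k l) *
       cond_expect M x xt eta k l.
    rewrite pair_big; apply: eq_bigr => -[k l] _ /=; congr (_ * _).
    by rewrite mxE.
  rewrite /c /stratum_gain; ring.
have -> : rho M x xt eta * expR c =
    \int[lebesgue_n R u]_(v in Upsilon M) (rho M x xt eta * expR c * F v).
  by rewrite RintegralZl// IF mulr1.
rewrite [leRHS]rhoE//; apply: le_Rintegral => //.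
- exact: integrableZl Fint.
- exact: rhobar_integrable.
move=> v Uv; rewrite rhobarE.
have -> : F v = cond_density M x xt eta v * (1 + (Delta v - c)).
  rewrite /F /Delta pair_big/=.
  under eq_bigr do rewrite mulrA.
  rewrite -mulr_suml; ring.
have -> : rhobar M x xt v eta = rho M x xt eta * cond_density M x xt eta v.
  by rewrite /cond_density mulrC divfK// gt_eqF.
have : 0 <= cond_density M x xt eta v.
  by apply: divr_ge0; [exact: (rhobar_ge0 A1)|exact: ltW].
move: (cond_density _ _ _ _ _) => K K0.
by rewrite -!mulrA ler_pM2l// mulrCA ler_wpM2l// expR_tangent.
Qed.

Hypothesis regular : regularity M.

Let eta_in th j : Theta M th -> eta_dom M (stratum th j).
Proof. exact: (Theta_eta_dom standing). Qed.

Let w_ge0 th j : Theta M th -> 0 <= weight th j.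
Proof. by move=> /(Theta_simplex standing)[+ _]; apply. Qed.

Let component_ge0 th j x xt : Theta M th ->
  0 <= weight th j * rho M x xt (stratum th j).
Proof.
by move=> T; apply: mulr_ge0; [exact: w_ge0|apply: rho_ge0; exact: eta_in].
Qed.

Let adj_ge0 i : 0 <= omega M i * psi M (ancestor M i).
Proof.
apply: mulr_ge0; [exact: (omega_ge0 standing)|exact/ltW/(psi_gt0 standing)].
Qed.

Lemma mixture_ge0 th x xt : Theta M th -> 0 <= mixture M th x xt.
Proof. by move=> T; apply: sumr_ge0 => j _; exact: component_ge0. Qed.

Lemma mubar_ge0 i xt : 0 <= mubar M i xt.
Proof.
rewrite divr_ge0 ?mulr_ge0 ?(omega_ge0 standing) ?(ell_ge0 standing)//.
exact: ltW (total_mass_gt0 standing).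
Qed.

Lemma mubar_integrable i : (lebesgue_n R pt).-integrable setT
  (EFin \o mubar M i).
Proof.
exact: integrableZr (integrableZl _ (omega M i) (ell_integrable standing _)).
Qed.

Let measurable_mubar i : measurable_fun setT (mubar M i).
Proof.
by apply/measurable_EFinP; have /integrableP[] := mubar_integrable i.
Qed.

Lemma measurable_mixture th x : Theta M th ->
  measurable_fun setT (mixture M th x).
Proof.
move=> T; apply: measurable_sum => j; apply: measurable_funM => //.
by apply: measurable_rho; exact: eta_in.
Qed.

Lemma resp_itv th j i xt : Theta M th -> 0 <= resp M th j i xt <= 1.
Proof.
move=> T; have t_ge0 := component_ge0 j (ancestor M i) xt T.
have S0 : 0 <= mixture M th (ancestor M i) xt by exact: mixture_ge0.
rewrite /resp divr_ge0//=.
(* Where the mixture vanishes the responsibility is 0, as [0^-1 = 0]. *)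
have [->|S_neq0] := eqVneq (mixture M th (ancestor M i) xt) 0.
  by rewrite invr0 mulr0.
rewrite ler_pdivrMr ?lt_def ?S_neq0// mul1r /mixture (bigD1 j)//= lerDl.
by apply: sumr_ge0 => k _; exact: component_ge0.
Qed.

Lemma resp_integrable th j i : Theta M th ->
  (lebesgue_n R pt).-integrable setT
    (EFin \o (fun xt => mubar M i xt * resp M th j i xt)).
Proof.
move=> T; apply: (le_integrable measurableT _ _ (mubar_integrable i)).
  apply/measurable_EFinP/measurable_funM => //.
  apply: measurable_fun_div; [|exact: measurable_mixture|].
    by apply: measurable_funM => //;
      apply: measurable_rho; exact: eta_in.
  by move=> xt; exact: mixture_ge0.
move=> xt _ /=; have /andP[r0 r1] := resp_itv j i xt T.
have mu0 := mubar_ge0 i xt; rewrite lee_fin !ger0_norm//.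
  by rewrite ler_piMr.
exact: mulr_ge0.
Qed.

Lemma measurable_log_ratio th i : Theta M th -> measurable_fun setT
  (fun xt => mubar M i xt * ln (mubar M i xt / proposal M th i xt)).
Proof.
move=> T; apply: measurable_funM => //; apply: measurableT_comp => //.
apply: measurable_fun_div => // [|xt].
  by apply: measurable_funM => //; exact: measurable_mixture.
apply: mulr_ge0; last exact: mixture_ge0.
apply: divr_ge0; [exact: adj_ge0|apply: sumr_ge0 => k _; exact: adj_ge0].
Qed.

(** A finite sum of extended reals is finite only if every term is, so each ancestor's integral is
    finite. *)
Lemma log_ratio_integrable th i : Theta M th -> dKL M th \is a fin_num ->
  (lebesgue_n R pt).-integrable setT
    (EFin \o fun xt => mubar M i xt * ln (mubar M i xt / proposal M th i xt)).
Proof.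
move=> T /sum_fin_numP fin; apply: fin_num_integrable => //.
  exact: measurable_log_ratio.
by apply: fin => //; rewrite mem_index_enum.
Qed.

Lemma fine_Emubar (f : 'I_N -> Rn R pt -> R) :
  (forall i, (lebesgue_n R pt).-integrable setT
     (EFin \o (fun xt => mubar M i xt * f i xt))) ->
  fine (Emubar M f) =
  \sum_i \int[lebesgue_n R pt]_xt (mubar M i xt * f i xt).
Proof.
move=> fint; rewrite -sum_fine// => i _.
exact: (integrable_fin_num measurableT (fint i)).
Qed.

(** The pointwise bound behind the minorization: the right-hand side reduces to [mubar] times the
    log-ratio of the two mixtures, to which [ln_ratio_ge] applies with the responsibilities as
    weights. *)
Lemma log_ratio_gain th th' i xt : Theta M th -> Theta M th' ->
  (forall j, 0 < weight th j) -> (forall j, 0 < weight th' j) ->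
  mubar M i xt * \sum_j resp M th j i xt *
    (ln (weight th' j) - ln (weight th j) +
     stratum_gain (ancestor M i) xt (stratum th j) (stratum th' j)) <=
  mubar M i xt * ln (mubar M i xt / proposal M th i xt) -
  mubar M i xt * ln (mubar M i xt / proposal M th' i xt).
Proof.
move=> T T' w0 w'0.
(* Both sides vanish with [mubar]; elsewhere domination makes the mixtures positive. *)
have := mubar_ge0 i xt; rewrite le_eqVlt => /predU1P[<-|mu0].
  by rewrite !mul0r subrr.
set x := ancestor M i.
have mix_gt0 t : Theta M t -> 0 < mixture M t x xt.
  move=> Tt; rewrite lt_neqAle mixture_ge0// andbT eq_sym.
  apply/eqP => /(proposal_dominates standing Tt) ell0.
  by move: mu0; rewrite /mubar -/x ell0 mulr0 mul0r ltxx.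
have om0 : 0 < omega M i.
  rewrite lt_neqAle (omega_ge0 standing) andbT eq_sym.
  by apply/eqP => om0; move: mu0; rewrite /mubar om0 !mul0r ltxx.
(* The ancestor factor of the proposal does not depend on the parameter and cancels in the
   difference. *)
pose C := omega M i * psi M x / (\sum_(k < N) omega M k * psi M (ancestor M k)).
have a0 : 0 < omega M i * psi M x.
  by apply: mulr_gt0 => //; exact: (psi_gt0 standing).
have C0 : 0 < C.
  apply: divr_gt0 => //; rewrite (bigD1 i)//= ltr_wpDr//.
  by apply: sumr_ge0 => k _; exact: adj_ge0.
have ln_ratioE t : Theta M t -> ln (mubar M i xt / proposal M t i xt) =
    ln (mubar M i xt) - (ln C + ln (mixture M t x xt)).
  move=> Tt; have m0 := mix_gt0 _ Tt.
  rewrite ln_div ?posrE//; last by apply: mulr_gt0.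
  by rewrite /proposal lnM ?posrE.
rewrite -mulrBr ler_pM2l// !ln_ratioE//.
have -> : forall a b c e : R, a - (b + c) - (a - (b + e)) = e - c.
  by move=> *; ring.
rewrite -ln_div ?posrE; [|exact: mix_gt0..].
apply: ln_ratio_ge => [j||j].
- exact: component_ge0.
- exact: mix_gt0.
(* Exponentiating turns the weight of [th] into that of [th']; [rho_stratum_gain] handles the
   density. *)
rewrite expRD (expRD (ln _)) expRN !lnK ?posrE//.
have -> : forall a b c e : R, 0 < a -> a * b * (c * a^-1 * e) = c * (b * e).
- by move=> a b c e a_gt0; field; rewrite gt_eqF.
- by rewrite ler_pM2l//; apply: rho_stratum_gain; exact: eta_in.
- exact: w0.
Qed.

(** Integrating [log_ratio_gain]: its left-hand side is linear in the responsibilities and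
    statistics, whose means are [pbar] and [sbar], and so integrates to the increase of l. *)
Lemma minorization th th' : Theta M th -> Theta M th' ->
  (forall j, 0 < weight th j) -> (forall j, 0 < weight th' j) ->
  dKL M th \is a fin_num -> dKL M th' \is a fin_num ->
  lfun_real M (sbar M th) (pbar M th) th' -
  lfun_real M (sbar M th) (pbar M th) th <= fine (dKL M th) - fine (dKL M th').
Proof.
move=> T T' w0 w'0 fin fin'.
(* A single index for stratum and matrix entry makes the statistics one finite linear
   combination. *)
pose J : finType := ('I_d * ('I_m * 'I_m'))%type.
have sum_tripleE (f : 'I_d -> 'I_m -> 'I_m' -> R) :
    \sum_(z : J) f z.1 z.2.1 z.2.2 = \sum_j \sum_k \sum_l f j k l.
  by under [RHS]eq_bigr do rewrite pair_big/=; rewrite pair_big.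
(* [kappa] and [db] are the coefficients of the p_j and of the entries of the s_j in the difference
   of l between [th'] and [th]. *)
pose kappa j := ln (weight th' j) - ln (weight th j) +
  (afun M (stratum th j) - afun M (stratum th' j)).
pose db j k l := bfun M (stratum th' j) k l - bfun M (stratum th j) k l.
pose S i j k l xt := mubar M i xt * resp_stat M th j k l i xt.
have Sint i j k l : (lebesgue_n R pt).-integrable setT (EFin \o S i j k l).
  exact: stat_integrable.
pose dbz (z : J) := db z.1 z.2.1 z.2.2.
pose Sz i (z : J) := S i z.1 z.2.1 z.2.2.
have Szint i z : (lebesgue_n R pt).-integrable setT (EFin \o Sz i z).
  exact: Sint.
have rint i j := resp_integrable j i T.
have int1 i := integrable_lincomb kappa measurableT (rint i).
have int2 i := integrable_lincomb dbz measurableT (Szint i).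
have -> : lfun_real M (sbar M th) (pbar M th) th' -
    lfun_real M (sbar M th) (pbar M th) th =
  \sum_i \int[lebesgue_n R pt]_xt
     (\sum_j kappa j * (mubar M i xt * resp M th j i xt) +
      \sum_z dbz z * Sz i z xt).
  have pE j : pbar M th j 0 =
      \sum_i \int[lebesgue_n R pt]_xt (mubar M i xt * resp M th j i xt).
    by rewrite mxE fine_Emubar.
  have sE j k l : sbar M th j k l =
      \sum_i \int[lebesgue_n R pt]_xt S i j k l xt.
    by rewrite mxE fine_Emubar// => i; exact: Sint.
  transitivity (\sum_j kappa j * pbar M th j 0 +
      \sum_(z : J) dbz z * sbar M th z.1 z.2.1 z.2.2).
    rewrite (sum_tripleE (fun j k l => db j k l * sbar M th j k l)).
    rewrite /lfun_real -sumrB -big_split; apply: eq_bigr => j _ /=.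
    under [X in _ = _ + X]eq_bigr do
      (under eq_bigr do rewrite mulrBl; rewrite sumrB).
    rewrite sumrB /kappa; ring.
  under [RHS]eq_bigr => i _ do rewrite RintegralD// !Rintegral_lincomb//.
  rewrite big_split/=; congr (_ + _); rewrite exchange_big/=;
    apply: eq_bigr => j _; rewrite -mulr_sumr; congr (_ * _).
    exact: pE.
  exact: sE.
have -> : fine (dKL M th) - fine (dKL M th') =
  \sum_i \int[lebesgue_n R pt]_xt
     (mubar M i xt * ln (mubar M i xt / proposal M th i xt) -
      mubar M i xt * ln (mubar M i xt / proposal M th' i xt)).
  rewrite !fine_Emubar => [|i|i]; try exact: log_ratio_integrable.
  rewrite -sumrB; apply: eq_bigr => i _.
  by rewrite -RintegralB//; exact: log_ratio_integrable.
apply: ler_sum => i _; apply: le_Rintegral => //.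
- exact: integrableD (int1 i) (int2 i).
- exact: (integrableB measurableT (log_ratio_integrable i T fin)
    (log_ratio_integrable i T' fin')).
move=> xt _; apply: le_trans (log_ratio_gain _ _ T T' w0 w'0).
rewrite le_eqVlt; apply/orP; left; apply/eqP.
rewrite (sum_tripleE (fun j k l => db j k l * S i j k l xt)).
rewrite -big_split mulr_sumr.
apply: eq_bigr => j _ /=.
rewrite /stratum_gain /kappa addrA [X in _ = _ * (_ * X)]addrA.
rewrite [in RHS]mulrDr [in RHS]mulrDr; congr (_ + _); first by ring.
rewrite !mulr_sumr; apply: eq_bigr => k _.
rewrite !mulr_sumr; apply: eq_bigr => l _.
by rewrite /db /S /resp_stat; ring.
Qed.

End jensen.

(** * Stationary points *)

Section fixed_points.
Variables (R : realType) (p pt u q m m' N d : nat).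
Variable M : mixture_model R p pt u q m m' N d.
Notation param := ('rV[R]_d * 'M[R]_(d, q))%type.
Implicit Types (th : param) (s : 'I_d -> 'M[R]_(m, m')) (pv : 'cV[R]_d).

(** Turns a root of the mean field into a fixed-point equation for the pair (s, p); each s_j is
    recovered as a diagonal block. *)
Lemma direct_sum_weights_inj s1 s2 pv1 pv2 :
  direct_sum_weights s1 pv1 = direct_sum_weights s2 pv2 ->
  s1 = s2 /\ pv1 = pv2.
Proof.
move=> /eq_block_mx[s12 _ _ pv12]; split=> //; apply/funext => j.
have := congr1 (fun A => submxblock (p_ := fun=> m) (q_ := fun=> m') A j j) s12.
by rewrite !mxblockK eqxx.
Qed.

Lemma expected_stat_weight0 th j : weight th j = 0 ->
  pbar M th j 0 = 0 /\ sbar M th j = 0.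
Proof.
move=> w0.
have r0 i xt : resp M th j i xt = 0 by rewrite /resp w0 !mul0r.
have E0 (f : 'I_N -> Rn R pt -> R) : (forall i xt, f i xt = 0) ->
    fine (Emubar M f) = 0.
  move=> f0; rewrite /Emubar big1// => i _.
  by apply: integral0_eq => xt _; rewrite f0 mulr0.
split; first by rewrite mxE E0.
by apply/matrixP => k l; rewrite !mxE E0// => i xt; rewrite /resp_stat r0 mul0r.
Qed.

(* If stratum j carries neither weight nor statistic then l does not depend on
   eta_j, which can be moved freely inside the open domain. *)
Lemma unique_max_nondegenerate s pv th j : (0 < q)%N -> regularity M ->
  unique_max_in (Theta M) (lfun M s pv) th -> pv j 0 = 0 -> s j = 0 -> False.
Proof.
move=> q_gt0 [[U oU TE] _ _ _ _] [Tth max_th uniq_th] pv0 s0.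
(* Moves the first coordinate of eta_j and leaves the weights unchanged. *)
pose v : param := (0, delta_mx j (Ordinal q_gt0)).
have [Uth Sth] : (U `&` @simplex_params R d q) th by rewrite -TE.
have near_U : \forall t \near (0 : R)^'+, U (th + t *: v).
  exact: cvg_line (open_nbhs_nbhs (conj oU Uth)).
have [t [Ut t0]] := filter_ex (filterI near_U (nbhs_right_gt (0 : R))).
have weightE : (th + t *: v).1 = th.1 by rewrite /= scaler0 addr0.
have Ttv : Theta M (th + t *: v).
  by rewrite TE; split=> //; split=> [k|]; rewrite weightE; case: Sth.
have lfunv : lfun M s pv (th + t *: v) = lfun M s pv th.
  have strE k : k != j -> stratum (th + t *: v) k = stratum th k.
    move=> kj; apply/rowP => l; rewrite !mxE (negbTE kj)/= mulr0 addr0//.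
  rewrite /lfun /weight weightE; congr (- _ + _ + _)%E;
    apply: eq_bigr => k _; have [->|kj] := eqVneq k j.
  - by rewrite pv0 !mulr0.
  - by rewrite strE.
  - by rewrite s0 !mulmx0.
  - by rewrite strE.
have /(congr1 (fun x : param => x.2 j (Ordinal q_gt0))) :=
  uniq_th _ Ttv (fun th' T' =>
    eq_ind_r (fun y => _ <= y)%E (max_th th' T') lfunv).
rewrite !mxE !eqxx /= mulr1 -[RHS]addr0 => /addrI tE.
by move: t0; rewrite tE /= ltxx.
Qed.

Hypothesis standing : standing_assumptions M.
Hypothesis regular : regularity M.
Hypothesis A1 : integrated_curved_exponential M.
Hypothesis A2 : cond_expect_defined M.

(** The maximiser [th'] may differ from [th]: in the converse direction their equality is still to
    be shown. *)
Lemma positive_weights th th' : (0 < q)%N -> Theta M th ->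
  unique_max_in (Theta M) (lfun M (sbar M th) (pbar M th)) th' ->
  forall j, 0 < weight th j.
Proof.
move=> q_gt0 Tth umax j.
rewrite lt_def (Theta_simplex standing Tth).1 andbT.
apply/eqP => /expected_stat_weight0[pv0 s0].
exact: (unique_max_nondegenerate q_gt0 regular umax pv0 s0).
Qed.

(** By [minorization], l plus the divergence has a local maximum at [th] along [Theta M], since
    nearby weights are positive and nearby divergences finite. *)
Lemma gradient_sum_tangent th g gl (v : param) : Theta M th ->
  (forall j, 0 < weight th j) ->
  has_gradient_in (Theta M) (dKL M) th g ->
  has_gradient_in (Theta M) (lfun M (sbar M th) (pbar M th)) th gl ->
  \sum_j v.1 0 j = 0 -> param_dot (gl + g) v = 0.
Proof.
move=> Tth w0 Dg lg; have [U oU TE] := Theta_open regular.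
have [Uth Sth] : (U `&` @simplex_params R d q) th by rewrite -TE.
apply: (local_max_gradient oU Uth Sth w0); rewrite -TE.
  exact: has_gradient_inD lg Dg.
have Dfin := has_gradient_near_fin Dg.
move: Dfin; rewrite !near_withinE.
move: (near_weight_gt0 w0); apply: filterS2 => th' w0' Dfin Tth'.
have Dthfin := Dg.1; have {}Dfin := Dfin Tth'.
rewrite /= !lfunE// -(fineK Dfin) -(fineK Dthfin) -!EFinD lee_fin.
have := minorization standing A1 A2 regular Tth Tth' w0 w0' Dthfin Dfin.
lra.
Qed.

End fixed_points.

Theorem proposition5p1 (R : realType) (p pt u q m m' N d : nat)
    (M : mixture_model R p pt u q m m' N d)
    (N_gt0 : (0 < N)%N) (d_gt0 : (0 < d)%N) (q_gt0 : (0 < q)%N)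
    (standing : standing_assumptions M) (regular : regularity M)
    (A1 : integrated_curved_exponential M)
    (A2 : cond_expect_defined M)
    (Pi : set 'cV[R]_d) (Sigma : set 'M[R]_(m, m'))
    (Pi_ge0 : forall pv, Pi pv -> forall j, 0 <= pv j 0)
    (thetabar : ('I_d -> 'M[R]_(m, m')) -> 'cV[R]_d ->
                'rV[R]_d * 'M[R]_(d, q))
    (A3 : forall s pv, (forall j, Sigma (s j)) -> Pi pv ->
      unique_max_in (Theta M) (lfun M s pv) (thetabar s pv)) :
  (forall s pv, (forall j, Sigma (s j)) -> Pi pv ->
     mean_field M thetabar s pv = 0 ->
     stationary_in (Theta M) (dKL M) (thetabar s pv))
  /\
  ((forall s pv th, (forall j, Sigma (s j)) -> Pi pv ->
      stationary_in (Theta M) (lfun M s pv) th -> th = thetabar s pv) ->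
   forall th, stationary_in (Theta M) (dKL M) th ->
     (forall j, Sigma (sbar M th j)) -> Pi (pbar M th) ->
     mean_field M thetabar (sbar M th) (pbar M th) = 0).
Proof.
have TS := Theta_simplex standing.
split.
  move=> s pv sS pP root; have umax := A3 _ _ sS pP.
  (* At a root, [s] and [pv] are the expected statistics at their own maximiser. *)
  have /direct_sum_weights_inj[sE pE] := subr0_eq root.
  set th := thetabar s pv in umax sE pE *.
  have [Tth max_th _] := umax.
  have w0 : forall j, 0 < weight th j.
    apply: (positive_weights standing regular (th' := th)) => //.
    by rewrite sE pE.
  have [g Dg] := dKL_differentiable regular Tth w0.
  have [gl lg] := lfun_differentiable s pv regular Tth
    (fun j => Theta_eta_dom standing j Tth) w0.
  split=> //; apply: (has_gradient_in0 TS Tth _ Dg) => v v0.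
  have [U oU TE] := Theta_open regular.
  have [Uth Sth] : (U `&` @simplex_params R d q) th by rewrite -TE.
  (* The gradient of l vanishes along the simplex because [th] maximises l; that of the divergence
     must then vanish too. *)
  have gl0 : param_dot gl v = 0.
    apply: (local_max_gradient oU Uth Sth w0 (f := lfun M s pv)) => //;
      rewrite -TE//.
    by rewrite near_withinE; apply: nearW.
  rewrite -sE -pE in lg.
  have := gradient_sum_tangent standing regular A1 A2 Tth w0 Dg lg v0.
  by rewrite param_dotD gl0 add0r.
move=> stat_max th [Tth Dth] sS pP.
have w0 := positive_weights standing regular q_gt0 Tth (A3 _ _ sS pP).
have [gl lg] := lfun_differentiable (sbar M th) (pbar M th) regular Tth
  (fun j => Theta_eta_dom standing j Tth) w0.
(* Once [th] is stationary for l, it is the maximiser, and both terms of the mean field coincide. *)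
suff /(stat_max _ _ _ sS pP) thE : 
    stationary_in (Theta M) (lfun M (sbar M th) (pbar M th)) th.
  by rewrite /mean_field -thE subrr.
split=> //; apply: (has_gradient_in0 TS Tth _ lg) => v v0.
rewrite -[gl]addr0.
exact: (gradient_sum_tangent standing regular A1 A2 Tth w0 Dth lg).
Qed.
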